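(* Let $F$ be a graph without isolated vertices, with $v\ge 3$ vertices and $\ell$ edges. If $\mathrm{wsat}(n,F)\le g^*_2(n-v)+\ell-1$ for all integers $n\ge v$, then $\mathrm{wsat}(n,F)=g^*_2(n-v)+\ell-1$ for all integers $n\ge v$.
   Context: All graphs are finite and simple. Given a graph $F$, an $F$-bootstrap percolation process is a sequence of graphs $H_0\subset H_1\subset\cdots\subset H_m$ on the same vertex set such that, for each $i=1,\ldots,m$, $H_i$ is obtained from $H_{i-1}$ by adding one edge that belongs to a copy of $F$ (a not necessarily induced subgraph isomorphic to $F$) in $H_i$. A graph $H$ on $[n]=\{1,\ldots,n\}$ is weakly $F$-saturated if there is an $F$-bootstrap percolation process $H=H_0\subset\cdots\subset H_m=K_n$. The number $\mathrm{wsat}(n,F)$ is the minimum number of edges of a weakly $F$-saturated graph on $[n]$. For a graph $F$ with $v$ vertices and $i\in[v]$, let $e_i=\min_{S\subset V(F),\,|S|=i}|E(F)\setminus E(F\setminus S)|-1$, where $F\setminus S$ is the subgraph of $F$ induced on $V(F)\setminus S$ (so $e_i+1$ is the minimum over $i$-sets $S$ of the number of edges of $F$ meeting $S$). Define $g^*_2:\mathbb{Z}_{\ge 0}\to\mathbb{Z}$ by $g^*_2(0)=0$ and, for $i\ge1$, $g^*_2(i)=\min(e_{i_1}+\cdots+e_{i_s})$, the minimum being over all $s\in[i]$ and all integers $1\le i_1,\ldots,i_s\le v-2$ with $i_1+\cdots+i_s=i$. *)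

(* Defs.v *)
From mathcomp Require Import all_boot all_order all_algebra.
Set Implicit Arguments.
Unset Strict Implicit.
Unset Printing Implicit Defensive.
Import Order.TTheory GRing.Theory Num.Theory.
Local Open Scope ring_scope.

(* A graph with vertex set the finite type T is given by its edge set,        *)
(* E : {set {set T}}, all of whose members are 2-element subsets of T.        *)
Definition complete_graph (T : finType) : {set {set T}} :=
  [set e : {set T} | #|e| == 2%N].

Definition simple_graph (T : finType) (E : {set {set T}}) : bool :=
  E \subset complete_graph T.

Definition no_isolated_vertex (T : finType) (E : {set {set T}}) : Prop :=
  forall x : T, exists2 e : {set T}, e \in E & x \in e.

(* E(F \ S), the edges of F that avoid S.                                     *)
Definition edges_avoiding (V : finType) (F : {set {set V}}) (S : {set V}) :
    {set {set V}} :=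
  [set a in F | [disjoint a & S]].

(* A copy of F in H is the image of F under an injection of the vertices that *)
(* maps edges of F to edges of H.                                             *)
Definition in_copy (V T : finType) (F : {set {set V}}) (H : {set {set T}})
    (e : {set T}) : bool :=
  [exists f : {ffun V -> T},
    [&& injectiveb f,
        [forall a in F, f @: a \in H] &
        [exists a in F, e == f @: a]]].

Definition bootstrap_step (V T : finType) (F : {set {set V}}) :
    rel {set {set T}} :=
  fun H H' => [exists e : {set T},
    [&& e \in complete_graph T :\: H, H' == e |: H & in_copy F H' e]].

(* The process H_0, H_1, ..., H_m, given as H_0 and Hs = [:: H_1; ...; H_m].  *)
Definition bootstrap_process (V T : finType) (F : {set {set V}})
    (H0 : {set {set T}}) (Hs : seq {set {set T}}) : bool :=
  simple_graph H0 && path (bootstrap_step F) H0 Hs.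

(* [connect] is boolean reachability by a finite path; the explicit form with *)
(* a process ending in the complete graph is weakly_saturatedP.               *)
Definition weakly_saturated (V T : finType) (F : {set {set V}})
    (H : {set {set T}}) : bool :=
  simple_graph H && connect (bootstrap_step F) H (complete_graph T).

Lemma weakly_saturatedP (V T : finType) (F : {set {set V}})
    (H : {set {set T}}) :
  reflect (exists2 Hs : seq {set {set T}},
             bootstrap_process F H Hs & last H Hs = complete_graph T)
          (weakly_saturated F H).
Proof.
apply: (iffP andP) => [[sH /connectP[Hs pH eH]]|[Hs /andP[sH pH] eH]].
  by exists Hs => //; apply/andP.
by split=> //; apply/connectP; exists Hs.
Qed.

Lemma complete_weakly_saturated (V T : finType) (F : {set {set V}}) :
  weakly_saturated F (complete_graph T).
Proof. by rewrite /weakly_saturated connect0 andbT /simple_graph. Qed.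

Definition wsat (n : nat) (V : finType) (F : {set {set V}}) : nat :=
  #|[arg min_(H < complete_graph 'I_n | weakly_saturated F H) #|H|]|.

Lemma wsatP (n : nat) (V : finType) (F : {set {set V}}) :
  (exists2 H : {set {set 'I_n}}, weakly_saturated F H & #|H| = wsat n F) /\
  (forall H : {set {set 'I_n}}, weakly_saturated F H -> (wsat n F <= #|H|)%N).
Proof.
rewrite /wsat; case: arg_minnP => [|H wH minH].
  exact: complete_weakly_saturated.
by split=> //; exists H.
Qed.

(* Every term is at most #|F|, so for 1 <= i <= #|V| the big minimum is the    *)
(* minimum over the (nonempty) family of i-sets S: see e_minP.                *)
Definition e_min (V : finType) (F : {set {set V}}) (i : nat) : int :=
  (\big[Order.min/#|F|%:Z]_(S : {set V} | #|S| == i)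
      #|F :\: edges_avoiding F S|%:Z) - 1.

Lemma e_minP (V : finType) (F : {set {set V}}) (i : nat) : (i <= #|V|)%N ->
  (exists2 S : {set V}, #|S| = i &
     e_min F i = #|F :\: edges_avoiding F S|%:Z - 1) /\
  (forall S : {set V}, #|S| = i ->
     e_min F i <= #|F :\: edges_avoiding F S|%:Z - 1).
Proof.
move=> iV; pose f S := #|F :\: edges_avoiding F S|%:Z : int.
have fle S : f S <= #|F|%:Z by rewrite /f lez_nat subset_leq_card ?subsetDl.
have [S0 S0i] : exists S : {set V}, #|S| == i.
  exists [set x in take i (enum V)].
  by rewrite cardsE (card_uniqP _) ?take_uniq ?enum_uniq // size_takel // -cardE.
split=> [|S /eqP Si]; last by rewrite lerD2r; apply: bigmin_le_cond.
have [S /eqP Si eS] :=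
  eq_bigmin S0 (fun S => #|S| == i) f S0i (fun S _ => fle S).
by exists S => //; rewrite /e_min eS.
Qed.

(* i_1, ..., i_s are the values t j : 'I_(v - 1), so that t j <= v - 2. The   *)
(* initial value is the sum for 1 + ... + 1 = i, which is one of the allowed  *)
(* decompositions when v >= 3: see g2starP.                                   *)
Definition g2star (V : finType) (F : {set {set V}}) (i : nat) : int :=
  if i is 0 then 0 else
  \big[Order.min/e_min F 1 *+ i]_(s < i.+1 | (0 < s)%N)
    \big[Order.min/e_min F 1 *+ i]_(t : {ffun 'I_s -> 'I_#|V|.-1} |
        [forall j, (0 < t j)%N] && ((\sum_j t j)%N == i))
      \sum_j e_min F (t j).

Lemma g2starP (V : finType) (F : {set {set V}}) (i : nat) :
  (3 <= #|V|)%N -> (0 < i)%N ->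
  (exists2 c : seq nat,
     [/\ (0 < size c <= i)%N, all (fun k => (1 <= k <= #|V| - 2)%N) c &
         sumn c = i] &
     g2star F i = \sum_(k <- c) e_min F k) /\
  (forall c : seq nat,
    [/\ (0 < size c <= i)%N, all (fun k => (1 <= k <= #|V| - 2)%N) c &
        sumn c = i] ->
    g2star F i <= \sum_(k <- c) e_min F k).
Proof.
move=> v3; case: i => // i _; set m := i.+1.
have ord_bnd (k : nat) : (1 <= k <= #|V| - 2)%N -> (k < #|V|.-1)%N.
  by case: #|V| v3 => [|[|[|v]]] //= _; rewrite subSS subSS subn0 => /andP[].
have o1 : (1 < #|V|.-1)%N by rewrite ord_bnd // subn_gt0 v3.
split; last first.
  move=> c [/andP[c0 cm] /allP cv cs].
  have ck (j : 'I_(size c)) : (1 <= nth 0%N c j <= #|V| - 2)%N.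
    by rewrite cv ?mem_nth.
  pose s : 'I_m.+1 := Ordinal (cm : (size c < m.+1)%N).
  pose t : {ffun 'I_s -> 'I_#|V|.-1} := [ffun j => Ordinal (ord_bnd _ (ck j))].
  have tE (j : 'I_(size c)) : t j = nth 0%N c j :> nat by rewrite ffunE.
  apply: (@bigmin_inf _ _ _ _ s) => //.
  apply: (@bigmin_inf _ _ _ _ t) => //.
    apply/andP; split; first by apply/forallP=> j; rewrite tE; case/andP: (ck j).
    apply/eqP; rewrite -[RHS]cs sumnE (big_nth 0%N) big_mkord.
    by apply: eq_bigr => j _; rewrite tE.
  rewrite [leRHS](big_nth 0%N) big_mkord le_eqVlt; apply/orP; left; apply/eqP.
  by apply: eq_bigr => j _; rewrite tE.
pose P (x : int) := exists2 c : seq nat,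
     [/\ (0 < size c <= m)%N, all (fun k => (1 <= k <= #|V| - 2)%N) c &
         sumn c = m] & x = \sum_(k <- c) e_min F k.
have P0 : P (e_min F 1 *+ m).
  exists (nseq m 1%N); first split.
  - by rewrite size_nseq leqnn.
  - by apply/allP=> k; rewrite mem_nseq => /andP[_ /eqP->]; rewrite subn_gt0.
  - by rewrite sumn_nseq mul1n.
  by rewrite big_nseq -GRing.iter_addr_0.
have Pmin x y : P x -> P y -> P (Order.min x y).
  by rewrite /Order.min; case: ifP.
apply: (big_ind P) => // s s0; apply: (big_ind P) => // t.
move=> /andP[/forallP t0 /eqP ts].
exists [seq (t j : nat) | j <- enum 'I_s]; last by rewrite big_map big_enum.
split; last by rewrite sumnE big_map big_enum.
- by rewrite size_map size_enum_ord s0 -ltnS ltn_ord.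
apply/allP=> k /mapP[j _ ->]; rewrite t0 /=.
by have := ltn_ord (t j); case: #|V| v3 (t j) => [|[|[|v]]].
Qed.

(* Main.v *)
(* Call the edges so far a graph G, and consider covers of G by vertex sets C *)
(* with at least v vertices, each costing g(|C| - v) + l - 1 (g = g2star),    *)
(* together with the uncovered edges of G, each costing 1. When an edge e     *)
(* closes a copy of F, either e is already covered, or fusing the copy with   *)
(* all cover sets that meet it in two or more vertices covers e at no extra   *)
(* cost: a cover set missing s of the vertices of the copy spans at most l -  *)
(* 1 - e_s of its edges, and g is subadditive and monotone with g(s) at most  *)
(* e_s. Hence the minimal cost, initially at most |E(H)|, does not increase   *)
(* along the process. For the complete graph every cover costs at least as    *)
(* much as the single set of all vertices, by further fusions; this proves    *)
(* wsat(n, F) >= g(n - v) + l - 1.                                            *)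

Require Import Defs.
From mathcomp Require Import all_boot all_order all_algebra.
From mathcomp Require Import zify.
Set Implicit Arguments.
Unset Strict Implicit.
Unset Printing Implicit Defensive.
Import Order.TTheory GRing.Theory Num.Theory.
Local Open Scope ring_scope.

(** * Subsets and injections with prescribed size or image *)

Lemma exists_subset_card (T : finType) (A : {set T}) (k : nat) :
  (k <= #|A|)%N -> exists2 B : {set T}, B \subset A & #|B| = k.
Proof.
move=> /card_geqP[s [s_uniq <- sA]]; exists [set x in s].
  by apply/subsetP=> x; rewrite inE => /sA.
by rewrite cardsE; apply/card_uniqP.
Qed.

Lemma exists_inj_imset (V T : finType) (A : {set T}) : #|A| = #|V| ->
  exists2 f : {ffun V -> T}, injective f & f @: setT = A.
Proof.
move=> AV.
pose f := [ffun y : V => enum_val (cast_ord (esym AV) (enum_rank y))].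
have f_inj : injective f.
  move=> y z; rewrite !ffunE => /enum_val_inj/cast_ord_inj.
  exact: enum_rank_inj.
exists f => //; apply/eqP; rewrite eqEcard card_imset // cardsT AV leqnn andbT.
by apply/subsetP=> _ /imsetP[y _ ->]; rewrite ffunE enum_valP.
Qed.

Lemma imset_preimset (V T : finType) (f : V -> T) (C : {set T}) :
  f @: (f @^-1: C) = f @: setT :&: C.
Proof.
apply/setP=> y; rewrite inE; apply/imsetP/andP=> [[x]|[/imsetP[x _ ->] fxC]].
  by rewrite inE => xC ->; rewrite imset_f.
by exists x; rewrite ?inE.
Qed.

Section LowerBound.
Variables (V : finType) (F : {set {set V}}).
Hypotheses (F_simple : simple_graph F) (F_no_isolated : no_isolated_vertex F).
Hypothesis v_ge3 : (3 <= #|V|)%N.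

Local Notation g := (g2star F).

(** * Monotonicity and subadditivity of [e_min] and [g2star] *)

Lemma e_min_le_size (i : nat) : (i <= #|V|)%N -> e_min F i <= #|F|%:Z - 1.
Proof.
move=> /(e_minP F)[[S _ ->] _]; rewrite lerD2r lez_nat.
by rewrite subset_leq_card ?subsetDl.
Qed.

(** An [i]-subset of an optimal [j]-set meets no more edges than the [j]-set does. *)
Lemma e_min_mono (i j : nat) : (i <= j)%N -> (j <= #|V|)%N ->
  e_min F i <= e_min F j.
Proof.
move=> ij jV; have [[S Sj ->] _] := e_minP F jV.
have [_ min_i] := e_minP F (leq_trans ij jV).
have [|S' sS S'i] := @exists_subset_card _ S i; first by rewrite Sj.
apply: le_trans (min_i _ S'i) _; rewrite lerD2r lez_nat subset_leq_card //.
apply/setDS/subsetP=> a; rewrite !inE => /andP[-> /=].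
exact: disjointWr.
Qed.

Lemma e_min1_ge0 : 0 <= e_min F 1.
Proof.
have [[S /eqP/cards1P[x ->] ->] _] := e_minP F (ltnW (ltnW v_ge3)).
have [a aF xa] := F_no_isolated x.
rewrite subr_ge0 lez_nat card_gt0; apply/set0Pn; exists a.
rewrite !inE aF andbT /=; apply/pred0Pn; exists x.
by rewrite /= xa in_set1 eqxx.
Qed.

Lemma e_min_ge0 (i : nat) : (0 < i <= #|V|)%N -> 0 <= e_min F i.
Proof. by case/andP=> i0 iV; apply: le_trans e_min1_ge0 (e_min_mono _ _). Qed.

Let part := [pred k : nat | (1 <= k <= #|V| - 2)%N].

(** Parts are positive, so the bound on their number is automatic; the empty decomposition matches
    [g 0 = 0]. *)
Lemma g2star_sumn_le (c : seq nat) : all part c ->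
  g (sumn c) <= \sum_(k <- c) e_min F k.
Proof.
case: c => [|k c] cP; first by rewrite big_nil.
have c0 : (0 < sumn (k :: c))%N.
  by move: cP => /= /andP[/andP[k0 _] _]; rewrite addn_gt0 k0.
have [_] := g2starP F v_ge3 c0; apply; split=> //; apply/andP; split=> //.
elim: {c0} (k :: c) cP => //= {}k {}c IH /andP[/andP[k0 _] /IH ck].
by rewrite -add1n leq_add.
Qed.

Lemma g2star_attained (i : nat) :
  exists c : seq nat,
    [/\ all part c, sumn c = i & g i = \sum_(k <- c) e_min F k].
Proof.
case: (posnP i) => [->|i0]; first by exists [::]; rewrite big_nil.
by have [[c [_ cP cs] ->] _] := g2starP F v_ge3 i0; exists c.
Qed.

(** Optimal decompositions of [i] and [j] concatenate. *)
Lemma g2starD_le (i j : nat) : g (i + j)%N <= g i + g j.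
Proof.
have [c [cP <- ->]] := g2star_attained i.
have [d [dP <- ->]] := g2star_attained j.
by rewrite -sumn_cat -big_cat g2star_sumn_le // all_cat cP.
Qed.

Lemma g2star_le_e_min (i : nat) : (1 <= i <= #|V| - 2)%N -> g i <= e_min F i.
Proof.
move=> iP; have := @g2star_sumn_le [:: i].
by rewrite big_seq1 /= addn0 andbT; apply.
Qed.

(** In an optimal decomposition of [i.+1], lower the first part by one, or drop it if it is 1; no
    term increases, since [e_min] is monotone and [e_min F 1] is nonnegative. *)
Lemma g2starS_le (i : nat) : g i <= g i.+1.
Proof.
have [[|k c] [cP //= cs ->]] := g2star_attained i.+1.
move: cP => /= /andP[/andP[k0 kv] cP].
rewrite big_cons; case: k k0 kv cs => // [[|k]] _ kv [<-].
  by rewrite -[g _]add0r lerD ?e_min1_ge0 ?g2star_sumn_le.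
have -> : (k.+1 + sumn c)%N = sumn (k.+1 :: c) by [].
apply: le_trans (g2star_sumn_le _) _; first by rewrite /= cP andbT (ltnW kv).
by rewrite big_cons lerD2r e_min_mono // (leq_trans kv) ?leq_subr.
Qed.

Lemma g2star_mono (i j : nat) : (i <= j)%N -> g i <= g j.
Proof.
move=> /subnK <-; elim: (j - i)%N => // d IH.
exact: le_trans IH (g2starS_le _).
Qed.

Lemma g2star_ge0 (i : nat) : 0 <= g i.
Proof. exact: (g2star_mono (leq0n i)). Qed.

Lemma F_neq0 : (0 < #|F|)%N.
Proof.
have /card_gt0P[x _] : (0 < #|V|)%N by apply: leq_trans v_ge3.
by have [a aF _] := F_no_isolated x; apply/card_gt0P; exists a.
Qed.

(** * Covers and their cost *)

Section Covers.
Variable T : finType.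
Implicit Types (C D : {set T}) (cc G : {set {set T}}) (f : {ffun V -> T}).

Definition weight C : int := g (#|C| - #|V|)%N + (#|F|%:Z - 1).

Definition uncovered cc G := [set e in G | [forall C in cc, ~~ (e \subset C)]].

Definition cost cc G : int := \sum_(C in cc) weight C + #|uncovered cc G|%:Z.

(** This keeps the truncated subtraction in [weight] exact on cover sets. *)
Definition large cc := forall C, C \in cc -> (#|V| <= #|C|)%N.

Lemma uncoveredP {cc G} (e : {set T}) :
  reflect (e \in G /\ forall C, C \in cc -> ~~ (e \subset C))
          (e \in uncovered cc G).
Proof.
rewrite inE; apply: (iffP andP) => [[-> /forall_inP //]|[-> h]].
by split=> //; apply/forall_inP.
Qed.

Lemma weight_ge0 C : 0 <= weight C.
Proof.
by have := g2star_ge0 (#|C| - #|V|); have := F_neq0; rewrite /weight; lia.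
Qed.

(** With two common vertices, the excess of the union over [#|V|] is at most the two excesses plus
    [#|V| - 2]. The last term costs at most [e_min F (#|V| - 2)], hence at most [#|F| - 1], the
    constant saved by having one set instead of two. *)
Lemma weight_setU C D : (#|V| <= #|C|)%N -> (#|V| <= #|D|)%N ->
  (2 <= #|C :&: D|)%N -> weight (C :|: D) <= weight C + weight D.
Proof.
move=> Cv Dv CD; have := cardsUI C D.
set u := #|C :|: D|; set i := #|C :&: D| in CD * => eq_u.
have u_le : (u - #|V| <= (#|C| - #|V|) + (#|D| - #|V|) + (#|V| - 2))%N by lia.
have := g2star_mono u_le.
have := g2starD_le (#|C| - #|V| + (#|D| - #|V|)) (#|V| - 2).
have := g2starD_le (#|C| - #|V|) (#|D| - #|V|).
have : g (#|V| - 2)%N <= e_min F (#|V| - 2)%N.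
  by apply: g2star_le_e_min; rewrite leqnn subn_gt0 v_ge3.
have := e_min_le_size (leq_subr 2 #|V|).
rewrite /weight -/u; lia.
Qed.

(** Only an inequality, because [D] may already belong to the remaining family and is then counted
    once. *)
Lemma cost_replace cc (J : {set {set T}}) D :
  J \subset cc ->
  \sum_(C in J) weight C + \sum_(C in D |: (cc :\: J)) weight C <=
  weight D + \sum_(C in cc) weight C.
Proof.
move=> Jcc; rewrite [X in _ <= _ + X](big_setID J) /= (setIidPr Jcc).
rewrite addrCA lerD2l.
have [DJ|DJ] := boolP (D \in cc :\: J); last by rewrite big_setU1.
by rewrite (setUidPr _) ?sub1set // lerDr weight_ge0.
Qed.

Definition edges_inside f C := [set a in F | f @: a \subset C].

(** The edges inside [C] are those avoiding the set [S] of vertices that [f] sends outside [C], and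
    at least [e_min F #|S| + 1] edges meet [S]. *)
Lemma card_edges_inside_le f C :
  e_min F #|~: (f @^-1: C)| + #|edges_inside f C|%:Z <= #|F|%:Z - 1.
Proof.
set S := ~: (f @^-1: C).
have [_ /(_ S erefl)] := e_minP F (max_card S : (#|S| <= #|V|)%N).
rewrite cardsD.
have -> : F :&: edges_avoiding F S = edges_inside f C.
  apply/setP=> a; rewrite !inE; case: (a \in F) => //=.
  by rewrite disjoints_subset setCK sub_imset_pre.
have : (#|edges_inside f C| <= #|F|)%N.
  by apply/subset_leq_card/subsetP=> a; rewrite inE => /andP[].
lia.
Qed.

(** * Fusing a copy of [F] with the cover sets it meets *)

(** Only a set holding two vertices of the copy can contain one of its edges. *)
Definition touched cc f := [set C in cc | (2 <= #|f @^-1: C|)%N].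

Definition merged cc f := f @: setT :|: \bigcup_(C in touched cc f) C.

Definition merge cc f := merged cc f |: (cc :\: touched cc f).

(** If [C] misses [s] vertices of the copy, it contributes [#|C| - (#|V| - s)] vertices beyond the
    copy. *)
Lemma card_merged cc f : injective f -> large cc ->
  (#|merged cc f| <= #|V| +
     \sum_(C in touched cc f) ((#|C| - #|V|) + #|~: (f @^-1: C)|))%N.
Proof.
move=> f_inj lcc.
have -> : merged cc f =
    f @: setT :|: \bigcup_(C in touched cc f) (C :\: f @: setT).
  apply/setP=> x; rewrite !inE; case: (boolP (x \in f @: _)) => //= xf.
  apply/bigcupP/bigcupP=> -[C CJ xC]; exists C => //; first by rewrite inE xf.
  by move: xC; rewrite inE => /andP[].
apply: leq_trans (leq_card_setU _ _) _.
apply: leq_add; first by rewrite card_imset // cardsT.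
apply: leq_trans (_ : _ <= \sum_(C in touched cc f) #|C :\: f @: setT|)%N _.
  elim/big_rec2: _ => [|C n X _ le_n]; first by rewrite cards0.
  by apply: leq_trans (leq_card_setU _ _) _; rewrite leq_add2l.
apply: leq_sum => C; rewrite inE => /andP[/lcc Cv _].
rewrite cardsD setIC -imset_preimset card_imset //.
have := cardsC (f @^-1: C); lia.
Qed.

(* An edge of the copy lying in a fused cover set C is paid for by the        *)
(* summand #|F| - 1 of the weight of C.                                       *)
Lemma cost_merge cc G f (e : {set T}) :
  injective f -> large cc ->
  (forall a, a \in F -> f @: a \in e |: G) ->
  (exists2 a, a \in F & e = f @: a) ->
  (forall C, C \in cc -> ~~ (f @: setT \subset C)) ->
  cost (merge cc f) (e |: G) <= cost cc G.
Proof.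
move=> f_inj lcc copy [a0 a0F e_a0] f_out.
set J := touched cc f; set U := merged cc f.
have fU (a : {set V}) : f @: a \subset U.
  by rewrite subsetU // imsetS ?subsetT.
have sJ C : C \in J -> C \subset U.
  by move=> CJ; apply: subset_trans (bigcup_sup C CJ) (subsetUr _ _).
pose FG : {set {set T}} := [set f @: (a : {set V}) | a in F].
have unc_sub : uncovered (merge cc f) (e |: G) \subset uncovered cc G :\: FG.
  apply/subsetP=> b /uncoveredP[bG b_out].
  have bU : ~~ (b \subset U) by rewrite b_out // setU11.
  rewrite inE; apply/andP; split.
    by apply/imsetP=> -[a _ b_a]; rewrite b_a fU in bU.
  apply/uncoveredP; split=> [|C Ccc].
    by case/setU1P: bG => // b_e; rewrite b_e e_a0 fU in bU.
  have [CJ|CJ] := boolP (C \in J).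
    by apply: contra bU => /subset_trans->//; apply: sJ.
  by rewrite b_out // in_setU1 in_setD CJ Ccc orbT.
have unc_le : (#|uncovered (merge cc f) (e |: G)| +
               #|uncovered cc G :&: FG| <= #|uncovered cc G|)%N.
  by rewrite -(cardsID FG (uncovered cc G)) addnC leq_add2l subset_leq_card.
(* Every edge of the copy other than [e] lies in [G], so it is either uncovered or inside a touched
   set. *)
have copy_le : (#|F| - 1 <= #|uncovered cc G :&: FG| +
    \sum_(C in J) #|edges_inside f C|)%N.
  have imf_inj : injective (fun a : {set V} => f @: a) by apply: imset_inj.
  have sub : F :\ a0 \subset [set a in F | f @: a \in uncovered cc G] :|:
      \bigcup_(C in J) edges_inside f C.
    apply/subsetP=> a; rewrite in_setD1 => /andP[a_a0 aF]; rewrite inE.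
    have faG : f @: a \in G.
      have /setU1P[fa_e|//] := copy _ aF.
      by move: a_a0; rewrite -(inj_eq imf_inj) fa_e e_a0 eqxx.
    have [//|fa_cov] := boolP (a \in _); apply/bigcupP.
    have [C Ccc faC] : exists2 C, C \in cc & f @: a \subset C.
      move: fa_cov; rewrite inE aF /= inE faG /= negb_forall_in.
      by case/exists_inP=> C Ccc; rewrite negbK; exists C.
    exists C; rewrite inE ?aF //= Ccc /=.
    have /subsetP/(_ _ aF) := F_simple; rewrite inE => /eqP <-.
    by apply: subset_leq_card; rewrite -sub_imset_pre.
  have := subset_leq_card sub.
  have := cardsD1 a0 F; rewrite a0F => ->; rewrite addKn => le1.
  apply: leq_trans le1 _; apply: leq_trans (leq_card_setU _ _) _.
  apply: leq_add.
    rewrite -(card_imset _ imf_inj); apply/subset_leq_card/subsetP=> b.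
    case/imsetP=> a; rewrite inE => /andP[aF fa] ->.
    by rewrite inE fa imset_f.
  elim/big_rec2: _ => [|C n X _ le_n]; first by rewrite cards0.
  by apply: leq_trans (leq_card_setU _ _) _; rewrite leq_add2l.
(* At least one vertex is missed because no cover set contains the copy, and at most [#|V| - 2]
   because two are hit; so [g2star_le_e_min] applies. *)
have sizeJ C : C \in J -> (1 <= #|~: (f @^-1: C)| <= #|V| - 2)%N.
  rewrite inE => /andP[Ccc C2]; have := cardsC (f @^-1: C).
  have : (#|f @^-1: C| < #|V|)%N; last by lia.
  rewrite -cardsT; apply: proper_card; rewrite properT.
  by apply: contra (f_out _ Ccc) => /eqP fC; rewrite sub_imset_pre fC.
have gU : g (#|U| - #|V|)%N <=
    \sum_(C in J) (g (#|C| - #|V|)%N + e_min F #|~: (f @^-1: C)|).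
  have U_le : (#|U| - #|V| <=
      \sum_(C in J) ((#|C| - #|V|) + #|~: (f @^-1: C)|))%N.
    by rewrite leq_subLR card_merged.
  apply: le_trans (g2star_mono U_le) _.
  elim/big_rec2: _ => // C y n CJ le_n.
  apply: le_trans (g2starD_le _ _) (lerD _ le_n).
  by apply: le_trans (g2starD_le _ _) (lerD _ (g2star_le_e_min (sizeJ C CJ))).
have sum_le : g (#|U| - #|V|)%N +
    (\sum_(C in J) #|edges_inside f C|)%N%:Z <=
    \sum_(C in J) weight C.
  apply: le_trans (lerD gU (lexx _)) _.
  rewrite -natz natr_sum -big_split /=; apply: ler_sum => C _.
  by rewrite natz -addrA lerD2l card_edges_inside_le.
have Jcc : J \subset cc by apply/subsetP=> C; rewrite inE => /andP[].
(* The touched weights pay for [g (#|U| - #|V|)] and the copy edges inside touched sets; the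
   uncovered copy edges, now covered, supply the rest of the constant [#|F| - 1] in the weight of
   [U]. *)
have := cost_replace U Jcc; rewrite [weight U]/weight /cost.
move: sum_le unc_le copy_le F_neq0; rewrite -/(merge cc f).
set y := g _; set M := \sum_(C in merge cc f) _; set S := \sum_(C in cc) _.
set N := \sum_(C in J) weight C.
lia.
Qed.

Lemma cost_fuse cc G C D : C \in cc -> D \in cc -> C != D -> large cc ->
  (2 <= #|C :&: D|)%N ->
  cost (C :|: D |: (cc :\: [set C; D])) G <= cost cc G.
Proof.
move=> Ccc Dcc CD lcc CD2; set dd := _ |: _.
have Jcc : [set C; D] \subset cc by rewrite subUset !sub1set Ccc.
have := cost_replace (C :|: D) Jcc; rewrite big_setU1 ?inE //= big_set1.
have := weight_setU (lcc C Ccc) (lcc D Dcc) CD2.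
have : (#|uncovered dd G| <= #|uncovered cc G|)%N.
  apply/subset_leq_card/subsetP=> b /uncoveredP[bG b_out].
  apply/uncoveredP; split=> // B Bcc.
  have bCD : ~~ (b \subset C :|: D) by rewrite b_out ?setU11.
  have [/set2P[->|->]|BJ] := boolP (B \in [set C; D]).
  - by apply: contra bCD => /subset_trans->//; apply: subsetUl.
  - by apply: contra bCD => /subset_trans->//; apply: subsetUr.
  by rewrite b_out // in_setU1 in_setD BJ Bcc orbT.
rewrite /cost -/dd.
set S := \sum_(B in cc) _; set M := \sum_(B in dd) _.
lia.
Qed.

Lemma large_merge cc f : injective f -> large cc -> large (merge cc f).
Proof.
move=> f_inj lcc C /setU1P[->|/setDP[/lcc //]].
by rewrite -cardsT -(card_imset _ f_inj) subset_leq_card ?subsetUl.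
Qed.

(** * Covers of the complete graph *)

Lemma imset_complete f a :
  injective f -> a \in F -> f @: a \in complete_graph T.
Proof.
by move=> f_inj /(subsetP F_simple); rewrite !inE card_imset.
Qed.

(** An edge already present plays the role of the new edge in [cost_merge], so [F] may be placed
    anywhere. *)
Lemma cost_merge_complete cc f : injective f -> large cc ->
  (forall C, C \in cc -> ~~ (f @: setT \subset C)) ->
  cost (merge cc f) (complete_graph T) <= cost cc (complete_graph T).
Proof.
move=> f_inj lcc f_out; have /card_gt0P[a aF] := F_neq0.
rewrite -[in leLHS](setUidPr _ : f @: a |: complete_graph T = _); last first.
  by rewrite sub1set imset_complete.
apply: cost_merge => // [b bF|]; last by exists a.
by rewrite setU1r ?imset_complete.
Qed.

(** Induction on the number of vertices outside [C]. If [x] is outside, place [F] on [x] and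
    [#|V| - 1] vertices of [C]. Either a cover set [D] contains this copy, and [C] is fused with
    [D], or the copy is merged with all sets it touches, [C] among them. Since [#|V| - 1] is at
    least 2, both moves are allowed, and the new set contains [C] and [x]. *)
Lemma weight_setT_le_cost_mem cc C : large cc -> C \in cc ->
  weight setT <= cost cc (complete_graph T).
Proof.
have [m] := ubnP #|~: C|; elim: m cc C => // m IH cc C Cm lcc Ccc.
have [C_T|] := eqVneq C setT.
  rewrite -C_T /cost (big_setD1 C) //= -addrA lerDl addr_ge0 //.
  by rewrite sumr_ge0 // => D _; apply: weight_ge0.
rewrite -subTset => /subsetPn[x _ xC].
have smaller D : C \subset D -> x \in D -> (#|~: D| < m)%N.
  move=> sCD xD; rewrite -ltnS (leq_trans _ Cm) // ltnS proper_card //.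
  by rewrite properE setCS sCD; apply/subsetPn; exists x; rewrite inE // xD.
have [B sBC cardB] : exists2 B : {set T}, B \subset C & #|B| = #|V|.-1.
  by apply/exists_subset_card/(leq_trans (leq_pred _))/lcc.
have xB : x \notin B by apply: contra xC; apply: subsetP.
have [|f f_inj fB] := @exists_inj_imset V T (x |: B).
  by rewrite cardsU1 xB cardB add1n prednK // (leq_trans _ v_ge3).
have B2 : (2 <= #|B|)%N by rewrite cardB -ltnS prednK // (leq_trans _ v_ge3).
have [/exists_inP[D Dcc sfD]|f_out] :=
    boolP [exists D in cc, f @: setT \subset D].
  have [xD sBD] : x \in D /\ B \subset D.
    by move: sfD; rewrite fB subUset sub1set => /andP.
  have CD : C != D by apply: contraNneq xC => ->.
  have CD2 : (2 <= #|C :&: D|)%N.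
    by apply: leq_trans B2 _; rewrite subset_leq_card // subsetI sBC.
  apply: le_trans (cost_fuse _ Ccc Dcc CD lcc CD2).
  apply: (IH _ (C :|: D)); rewrite ?setU11 //.
    by rewrite smaller ?subsetUl // inE xD orbT.
  move=> E /setU1P[->|/setDP[/lcc //]].
  by apply: leq_trans (lcc C Ccc) _; rewrite subset_leq_card ?subsetUl.
have {}f_out D : D \in cc -> ~~ (f @: setT \subset D).
  by move=> Dcc; apply: contra f_out => sfD; apply/exists_inP; exists D.
apply: le_trans (cost_merge_complete f_inj lcc f_out).
apply: (IH _ (merged cc f)); rewrite ?setU11 //; last exact: large_merge.
have CJ : C \in touched cc f.
  rewrite inE Ccc -(card_imset _ f_inj) imset_preimset (leq_trans B2) //.
  by rewrite subset_leq_card // subsetI sBC fB subsetUr.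
rewrite smaller ?inE ?fB ?setU11 //.
exact: subset_trans (bigcup_sup C CJ) (subsetUr _ _).
Qed.

Lemma weight_setT_le_cost cc : (#|V| <= #|T|)%N -> large cc ->
  weight setT <= cost cc (complete_graph T).
Proof.
move=> VT lcc; have [->|/set0Pn[C]] := eqVneq cc set0; last first.
  exact: weight_setT_le_cost_mem.
(* From the empty cover, one merge along any placement of [F] yields a cover set to start from. *)
have [|A _ AV] := @exists_subset_card T setT #|V|; first by rewrite cardsT.
have [f f_inj _] := exists_inj_imset AV.
have l0 : large set0 by move=> C; rewrite inE.
apply: (le_trans _ (cost_merge_complete f_inj l0 _)); last first.
  by move=> C; rewrite inE.
apply: (@weight_setT_le_cost_mem _ (merged set0 f)); last exact: setU11.
exact: large_merge.
Qed.

(** * Cost along the bootstrap process, and the lower bound *)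

Lemma bootstrap_step_cost cc G G' : bootstrap_step F G G' -> large cc ->
  exists2 cc', large cc' & cost cc' G' <= cost cc G.
Proof.
case/existsP=> e /and3P[_ /eqP-> /existsP[f /and3P[/injectiveP f_inj]]].
move=> /forall_inP copy /exists_inP[a aF /eqP e_a] lcc.
have [/exists_inP[C Ccc sfC]|f_out] :=
    boolP [exists C in cc, f @: setT \subset C].
  exists cc => //; rewrite lerD2l lez_nat.
  apply/subset_leq_card/subsetP=> b /uncoveredP[/setU1P[b_e|bG] b_out].
    have := b_out C Ccc; rewrite b_e e_a.
    by rewrite (subset_trans _ sfC) // imsetS ?subsetT.
  exact/uncoveredP.
exists (merge cc f); first exact: large_merge.
apply: cost_merge => // [|C Ccc]; first by exists a.
by apply: contra f_out => sfC; apply/exists_inP; exists C.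
Qed.

Lemma weakly_saturated_card_ge G : (#|V| <= #|T|)%N ->
  weakly_saturated F G -> weight setT <= #|G|%:Z.
Proof.
move=> VT /weakly_saturatedP[Gs /andP[_ Gpath] Glast].
have l0 : large set0 by move=> C; rewrite inE.
(* The empty cover leaves every edge uncovered, at cost 1 each. *)
have -> : #|G|%:Z = cost set0 G.
  rewrite /cost big_set0 add0r; congr Posz; apply: eq_card => b.
  by apply/idP/uncoveredP=> [bG|[]//]; split=> // C; rewrite inE.
suff [cc lcc] : exists2 cc, large cc &
    cost cc (complete_graph T) <= cost set0 G.
  exact: le_trans (weight_setT_le_cost VT lcc).
rewrite -Glast; elim: Gs G set0 l0 {Glast} Gpath => [|G1 Gs IH] G cc lcc /=.
  by exists cc.
case/andP=> /bootstrap_step_cost/(_ lcc)[cc1 lcc1 le1] /(IH _ _ lcc1)[cc' lcc'].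
by exists cc' => //; apply: le_trans le1.
Qed.

End Covers.
End LowerBound.

Theorem theorem5p3 (V : finType) (F : {set {set V}})
    (F_simple : simple_graph F) (F_no_isolated : no_isolated_vertex F)
    (v_ge3 : (3 <= #|V|)%N)
    (wsat_le : forall n : nat, (#|V| <= n)%N ->
      (wsat n F)%:Z <= g2star F (n - #|V|)%N + #|F|%:Z - 1) :
  forall n : nat, (#|V| <= n)%N ->
    (wsat n F)%:Z = g2star F (n - #|V|)%N + #|F|%:Z - 1.
Proof.
move=> n Vn; apply/le_anti; rewrite wsat_le //=.
have [[G Gsat <-] _] := wsatP n F.
have := weakly_saturated_card_ge F_simple F_no_isolated v_ge3 _ Gsat.
by rewrite /weight cardsT card_ord addrA; apply.
Qed.
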